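(* Let $K\subseteq\mathbf{R}^n$ be a nonempty closed convex set, let $f=(f_1,\dots,f_s):\mathbf{R}^n\to\mathbf{R}^s$ be a vector polynomial with $\deg f_i=d_i\ge 1$ for $i=1,\dots,s$, and let $\mathbf{d}=(d_1,\dots,d_s)$. Assume that $\mathrm{PVOP}(K,f)$ is strongly regular. Then: (i) $SOL^{w}(K,\cdot)$ is locally bounded at $f$, i.e., there exists $\delta>0$ such that $Q_\delta=\bigcup_{h\in\mathbf{B}(0,\delta)}SOL^{w}(K,f+h)$ is bounded, where $\mathbf{B}(0,\delta)$ is the open ball in $\mathbf{P}_{\mathbf{d}}$ with center $0$ and radius $\delta$. (ii) The set-valued mapping $SOL^{w}(K,\cdot):\mathbf{P}_{\mathbf{d}}\rightrightarrows\mathbf{R}^n$ is upper semi-continuous on $\mathbf{GR}^{\mathbf{d}}_{s}$ (that is, at every point of $\mathbf{GR}^{\mathbf{d}}_{s}$).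
   Context: $\mathbf{R}^s_+$ is the nonnegative orthant. For a nonempty closed set $C\subseteq\mathbf{R}^n$ and a vector polynomial $h:\mathbf{R}^n\to\mathbf{R}^s$, $\mathrm{PVOP}(C,h)$ is the problem of minimizing $h$ over $C$ with respect to $\mathbf{R}^s_+$, and $SOL^{w}(C,h)$ (weak Pareto efficient solutions) is the set of $x^*\in C$ such that $h(x)-h(x^* )\notin-\mathrm{int}\,\mathbf{R}^s_+$ for all $x\in C$. The asymptotic cone of $K$ is $K_\infty=\{v\in\mathbf{R}^n:\text{ there exist } t_k\to+\infty \text{ and } x_k\in K \text{ with } x_k/t_k\to v\}$. For a vector polynomial $p=(p_1,\dots,p_s)$ with component degrees $\deg p_i$, $p^\infty=(p_1^\infty,\dots,p_s^\infty)$ where $p_i^\infty(x)=\lim_{\lambda\to+\infty}p_i(\lambda x)/\lambda^{\deg p_i}$. $\mathrm{PVOP}(K,p)$ is strongly regular if $SOL^{w}(K_\infty,p^\infty)$ is bounded (the empty set counts as bounded). $\mathbf{P}_d$ is the finite-dimensional space of real polynomials in $n$ variables of degree at most $d$, normed by the Euclidean norm of the coefficient vector; $\mathbf{P}_{\mathbf{d}}=\mathbf{P}_{d_1}\times\dots\times\mathbf{P}_{d_s}$ carries the corresponding product norm (e.g. the Euclidean norm of all coefficients). $\mathbf{GR}^{\mathbf{d}}_{s}$ is the set of vector polynomials $p$ with $\deg p_i=d_i$ for $i=1,\dots,s$ such that $\mathrm{PVOP}(K,p)$ is strongly regular. A set-valued mapping $T$ is upper semi-continuous at $x$ if for every neighborhood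 $U$ of $T(x)$ there is a neighborhood $V$ of $x$ such that $T(y)\subseteq U$ for every $y\in V$. *)

(* Defs.v *)
From mathcomp Require Import all_boot all_order all_algebra.
From mathcomp Require Import all_classical all_reals all_analysis.
(* The notations of [mpoly] clash with those of MathComp-Analysis:
   [{mpoly R[n]}] is written [mpoly n R], ['X_{1..n < k}] is
   [bmultinom n k] and [p@_m] is [mcoeff m p]. *)
From mathcomp Require Import -(notations) mpoly.

Set Implicit Arguments.
Unset Strict Implicit.
Unset Printing Implicit Defensive.

Import Order.TTheory GRing.Theory Num.Theory.
Import numFieldNormedType.Exports.

Local Open Scope classical_set_scope.
Local Open Scope ring_scope.

Definition nonneg_orthant (R : realType) (s : nat) : set 'rV[R]_s :=
  [set y | forall i, 0 <= y ord0 i].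

(* SOL^w(C, h), for an arbitrary map [h] *)
Definition weak_pareto (R : realType) (n s : nat)
    (C : set 'rV[R]_n) (h : 'rV[R]_n -> 'rV[R]_s) : set 'rV[R]_n :=
  [set z | C z /\
     forall x, C x -> ~ (-%R @` interior (@nonneg_orthant R s)) (h x - h z)].

Definition asymptotic_cone (R : realType) (n : nat) (K : set 'rV[R]_n) :
    set 'rV[R]_n :=
  [set v | exists (t : nat -> R) (x : nat -> 'rV[R]_n),
    [/\ t k @[k --> \oo] --> +oo,
        forall k, K (x k) &
        (t k)^-1 *: x k @[k --> \oo] --> v]].

Definition peval (R : realType) (n : nat) (p : mpoly n R) (x : 'rV[R]_n) : R :=
  meval (fun j => x ord0 j) p.

(* total degree; [mmeasure mdeg] is [msize], so the zero polynomial gets 0 *)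
Definition pdeg (R : realType) (n : nat) (p : mpoly n R) : nat :=
  (mmeasure mdeg p).-1.

Notation vpoly R n s := ('I_s -> mpoly n R).

Definition vpeval (R : realType) (n s : nat) (p : vpoly R n s)
    (x : 'rV[R]_n) : 'rV[R]_s :=
  \row_i peval (p i) x.

(* p^oo; the limit exists for every polynomial *)
Definition recession (R : realType) (n s : nat) (p : vpoly R n s)
    (x : 'rV[R]_n) : 'rV[R]_s :=
  \row_i lim (peval (p i) (l *: x) / l ^+ pdeg (p i) @[l --> +oo%R]).

Definition strongly_regular (R : realType) (n s : nat)
    (K : set 'rV[R]_n) (p : vpoly R n s) : Prop :=
  bounded_set (weak_pareto (asymptotic_cone K) (recession p)).

Definition solution_map (R : realType) (n s : nat) (K : set 'rV[R]_n)
    (p : vpoly R n s) : set 'rV[R]_n :=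
  weak_pareto K (vpeval p).

(* P_d = P_{d_1} x ... x P_{d_s} *)
Definition Pspace (R : realType) (n s : nat) (d : 'I_s -> nat) :
    set (vpoly R n s) :=
  [set p | forall i, (pdeg (p i) <= d i)%N].

(* Euclidean norm of all the coefficients of an element of P_d; the inner sum
   ranges over the monomials of degree at most [d i] *)
Definition Pnorm (R : realType) (n s : nat) (d : 'I_s -> nat)
    (p : vpoly R n s) : R :=
  Num.sqrt (\sum_(i < s) \sum_(m : bmultinom n (d i).+1)
              mcoeff (bmnm m) (p i) ^+ 2).

Definition Pball (R : realType) (n s : nat) (d : 'I_s -> nat)
    (p : vpoly R n s) (e : R) : set (vpoly R n s) :=
  [set q | Pspace d q /\ Pnorm d (q - p) < e].

(* neighborhoods of [p] in the normed space P_d *)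
Definition Pnbhs (R : realType) (n s : nat) (d : 'I_s -> nat)
    (p : vpoly R n s) : set_system (vpoly R n s) :=
  filter_from [set e : R | 0 < e] (Pball d p).

(* Upper semi-continuity at [x] of a set-valued map whose domain carries the
   neighborhood system [N]; the neighborhoods of the set [T x] are the
   supersets of open sets containing it. *)
Definition upper_semicontinuous_at (X : Type) (Y : topologicalType)
    (N : X -> set_system X) (T : X -> set Y) (x : X) : Prop :=
  forall U : set Y, set_nbhs (T x) U -> N x [set y | T y `<=` U].

Definition GR (R : realType) (n s : nat) (K : set 'rV[R]_n)
    (d : 'I_s -> nat) : set (vpoly R n s) :=
  [set p | (forall i, pdeg (p i) = d i) /\ strongly_regular K p].

(* Main.v *)
(* If solutions x_k of problems K, p_k with p_k -> p were unbounded, rescale them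
   by t_k -> +oo so that x_k / t_k converges to some w <> 0 in K_oo. For u in
   K_oo the point x_0 + t_k u lies in K, so some component of p_k at x_k is at
   most its value at x_0 + t_k u; dividing by t_k ^ d_i and passing to the limit
   shows that w is a weak solution of the recession problem, of norm larger than
   its bound. Upper semi-continuity follows from local boundedness by extracting
   a convergent subsequence of solutions of the perturbed problems. *)
Require Import Defs.
From mathcomp Require Import all_boot all_order all_algebra.
From mathcomp Require Import all_classical all_reals all_analysis.
From mathcomp Require Import -(notations) mpoly.
Set Implicit Arguments.
Unset Strict Implicit.
Unset Printing Implicit Defensive.

Import Order.TTheory GRing.Theory Num.Theory.
Import numFieldNormedType.Exports.
Local Open Scope classical_set_scope.
Local Open Scope ring_scope.

(** * Homogenization and recession polynomials *)

(* The slice at [r] of the degree-[d] homogenization of [p]: [r = 1] gives [p]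
   and, when [d = pdeg p], [r = 0] gives [p^oo]. *)
Definition homogenization (R : realType) (n d : nat) (p : mpoly n R)
    (r : R) (z : 'rV[R]_n) : R :=
  \sum_(m : bmultinom n d.+1)
    mcoeff (bmnm m) p * r ^+ (d - mdeg (bmnm m)) *
    \prod_(j < n) z ord0 j ^+ (bmnm m) j.

(** A monomial of degree [e <= d] picks up the factor [l ^+ e / l ^+ d], which is
    [l^-1 ^+ (d - e)]. *)
Lemma peval_scale (R : realType) (n d : nat) (p : mpoly n R) (l : R)
    (z : 'rV[R]_n) :
  (pdeg p <= d)%N -> l != 0 ->
  peval p (l *: z) / l ^+ d = homogenization d p l^-1 z.
Proof.
move=> pd l0.
have sp : (mmeasure mdeg p <= d.+1)%N.
  by move: pd; rewrite /pdeg; case: mmeasure.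
rewrite /peval {1}(mpolywE sp) raddf_sum mulr_suml; apply: eq_bigr => m _ /=.
rewrite mevalZ mevalX /= -!mulrA; congr (_ * _).
under eq_bigr do rewrite mxE exprMn.
rewrite big_split /= -expr_sum mulrAC -mdegE; congr (_ * _).
have := bmdeg m; rewrite ltnS => md.
have -> : l ^+ d = l ^+ (d - mdeg (bmnm m)) * l ^+ mdeg (bmnm m).
  by rewrite -exprD subnK.
by rewrite invfM mulrCA divff ?mulr1 ?exprVn ?expf_neq0.
Qed.

Lemma peval_homogenization (R : realType) (n d : nat) (p : mpoly n R)
    (z : 'rV[R]_n) :
  (pdeg p <= d)%N -> peval p z = homogenization d p 1 z.
Proof.
move=> pd; have := @peval_scale R n d p 1 z pd (oner_neq0 _).
by rewrite scale1r expr1n divr1 invr1.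
Qed.

(** Joint continuity in coefficients, slice parameter and point, so that all three may vary in a
    single limit. *)
Lemma cvg_homogenization (R : realType) (n d : nat) (T : Type)
    (F : set_system T) (FF : Filter F) (q : T -> mpoly n R) (p : mpoly n R)
    (r : T -> R) (r0 : R) (x : T -> 'rV[R]_n) (z : 'rV[R]_n) :
  (forall m : bmultinom n d.+1,
     mcoeff (bmnm m) (q t) @[t --> F] --> mcoeff (bmnm m) p) ->
  r t @[t --> F] --> r0 -> x t @[t --> F] --> z ->
  homogenization d (q t) (r t) (x t) @[t --> F] --> homogenization d p r0 z.
Proof.
move=> qp rr xz; apply: cvg_big; first exact: add_continuous.
move=> m _; apply: cvgM; first apply: cvgM => //.
  apply: (cvg_comp r (fun a => a ^+ (d - mdeg (bmnm m))) rr).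
  exact: exprn_continuous.
apply: cvg_big; first exact: mul_continuous.
move=> j _; apply: (cvg_comp (fun t => x t ord0 j) (fun a => a ^+ (bmnm m) j)).
  apply: (cvg_comp x (fun a : 'rV[R]_n => a ord0 j) xz).
  exact: coord_continuous.
exact: exprn_continuous.
Qed.

(** As [l] tends to [+oo] the slice parameter [l^-1] tends to 0; since [0 ^+ 0 = 1], exactly the
    terms of top degree survive. *)
Lemma recessionE (R : realType) (n s : nat) (p : vpoly R n s)
    (z : 'rV[R]_n) (i : 'I_s) :
  recession p z ord0 i = homogenization (pdeg (p i)) (p i) 0 z.
Proof.
rewrite mxE; apply: cvg_lim => //.
apply: (@cvg_trans _
  (homogenization (pdeg (p i)) (p i) l^-1 z @[l --> +oo%R])).
  apply: near_eq_cvg; near=> l.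
  rewrite peval_scale//; by apply: lt0r_neq0; near: l; exact: nbhs_pinfty_gt.
apply: cvg_homogenization; [| |exact: cvg_cst];
  last by apply/gtr0_cvgV0 => //; exact: nbhs_pinfty_gt.
by move=> m; exact: cvg_cst.
Unshelve. all: by end_near. Qed.

(** * Weak efficiency in coordinates *)

Lemma interior_nonneg_orthant (R : realType) (s : nat) (y : 'rV[R]_s) :
  interior (@nonneg_orthant R s) y <-> forall i, 0 < y ord0 i.
Proof.
split=> [|y0].
  move=> /nbhs_ballP[e e0 ye] i.
  (* Moving [y] by [e / 2] down the diagonal stays in the ball, hence in the orthant, so every
     coordinate of [y] is at least [e / 2]. *)
  have /ye/(_ i) : ball y e (y - (e / 2) *: const_mx 1).
    split => // a b; rewrite !mxE mulr1 /ball/= opprB addrCA subrr addr0.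
    by rewrite gtr0_norm ?divr_gt0// ltr_pdivrMr// ltr_pMr// ltr1n.
  rewrite !mxE mulr1 subr_ge0; apply: lt_le_trans; exact: divr_gt0.
have : \forall z \near y, forall i, 0 < (z : 'rV[R]_s) ord0 i.
  apply: (@filter_forall _ _ (fun i (z : 'rV[R]_s) => 0 < z ord0 i) _
    (nbhs_filter y)) => i.
  have : (z : 'rV[R]_s) ord0 i @[z --> y] --> y ord0 i.
    exact: coord_continuous.
  by move/cvgr_gt; exact.
by apply: filterS => z z0 i; exact/ltW.
Qed.

Lemma weak_paretoE (R : realType) (n s : nat) (C : set 'rV[R]_n)
    (h : 'rV[R]_n -> 'rV[R]_s) (z : 'rV[R]_n) :
  weak_pareto C h z <->
  C z /\ forall x, C x -> exists i, h z ord0 i <= h x ord0 i.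
Proof.
split=> -[Cz zh]; split=> // x Cx.
  apply: contra_notP (zh x Cx) => /forallNP xz; exists (h z - h x).
    apply/interior_nonneg_orthant => i; rewrite !mxE subr_gt0 ltNge.
    exact/negP/xz.
  by rewrite opprB.
have [i zi] := zh x Cx => -[y /interior_nonneg_orthant/(_ i) yi /(congr1 -%R)].
rewrite opprK opprB => yE.
by move: yi; rewrite yE !mxE subr_gt0 ltNge zi.
Qed.

(** The index may change with [t], but there are finitely many: if every limit inequality failed,
    all the reversed strict ones would hold together at some [t]. *)
Lemma cvg_exists_le (R : realType) (I : finType) (T : Type)
    (F : set_system T) (FF : ProperFilter F) (a b : I -> T -> R)
    (a0 b0 : I -> R) :
  (forall t, exists i, a i t <= b i t) ->
  (forall i, a i t @[t --> F] --> a0 i) ->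
  (forall i, b i t @[t --> F] --> b0 i) ->
  exists i, a0 i <= b0 i.
Proof.
move=> ab aa bb; apply: contrapT => /forallNP nab.
have : \forall t \near F, forall i, b i t < a i t.
  apply: filter_forall => i; have /negP := nab i; rewrite -ltNge => ba.
  have : (a i t - b i t) @[t --> F] --> a0 i - b0 i by exact: cvgB.
  move=> /cvgr_gt/(_ 0); rewrite subr_gt0 => /(_ ba).
  by apply: filterS => t; rewrite subr_gt0.
move=> /filter_ex[t bat]; have [i] := ab t.
by rewrite leNgt bat.
Qed.

(** * Extraction of limits *)

Lemma bounded_subsequence (R : realType) (n : nat) (u : nat -> 'rV[R]_n)
    (M : R) :
  (forall k, `|u k| <= M) ->
  exists (phi : nat -> nat) (w : 'rV[R]_n),
    phi k @[k --> \oo] --> \oo /\ u (phi k) @[k --> \oo] --> w.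
Proof.
move=> uM.
have cB : compact [set x : 'rV[R]_n | `|x| <= M].
  apply: bounded_closed_compact.
    exists M; split=> [|B MB x /= /le_trans]; first exact: num_real.
    by apply; exact: ltW.
  apply: (@preimage_closed _ _ (fun x : 'rV[R]_n => `|x|) [set r | r <= M]);
    [move=> x _; exact: norm_continuous|exact: closed_le].
have [|w [_ wc]] := cB (u k @[k --> \oo]) (fmap_proper_filter _ _).
  by exists 0%N => // k _; exact: uM.
(* The cluster point [w] meets every tail of [u] within [harmonic k]. The resulting [phi] need not
   be monotone; divergence is enough to compose limits. *)
have /choice[phi phiP] : forall k : nat,
    exists j, (k <= j)%N /\ `|w - u j| < harmonic k.
  move=> k.
  have [||x [[j kj <-] xw]] :=
    wc [set u j | j in [set j | (k <= j)%N]] (ball w (harmonic k)).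
  - by exists k => // j /= kj; exists j.
  - by apply: nbhsx_ballx; exact: harmonic_gt0.
  - by exists j; split=> //; move: xw; rewrite -ball_normE.
exists phi, w; split.
  apply/cvgnyPge => A; near=> k; apply: (@leq_trans k).
    near: k; exact: nbhs_infty_ge.
  by have [] := phiP k.
apply/cvgrPdist_lt => e e0; near=> k.
have [_ /lt_trans] := phiP k; apply.
near: k; have /cvgr_lt := @cvg_harmonic R; exact.
Unshelve. all: by end_near. Qed.

Lemma coef_le_Pnorm (R : realType) (n s : nat) (d : 'I_s -> nat)
    (p : vpoly R n s) (i : 'I_s) (m : bmultinom n (d i).+1) :
  `|mcoeff (bmnm m) (p i)| <= Pnorm d p.
Proof.
rewrite -sqrtr_sqr; apply: ler_wsqrtr.
rewrite (bigD1 i)//= (bigD1 m)//= -addrA lerDl addr_ge0//.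
  by apply: sumr_ge0 => ? _; exact: sqr_ge0.
by apply: sumr_ge0 => ? _; apply: sumr_ge0 => ? _; exact: sqr_ge0.
Qed.

Lemma cvg_coef_Pball (R : realType) (n s : nat) (d : 'I_s -> nat)
    (p : vpoly R n s) (q : nat -> vpoly R n s) :
  (forall k, Pball d p (harmonic k) (q k)) ->
  forall i (m : bmultinom n (d i).+1),
    mcoeff (bmnm m) (q k i) @[k --> \oo] --> mcoeff (bmnm m) (p i).
Proof.
move=> qp i m; apply/cvgrPdist_lt => e e0; near=> k.
have [_ /(le_lt_trans (coef_le_Pnorm _ m))] := qp k.
rewrite mcoeffB distrC => /lt_trans; apply.
near: k; have /cvgr_lt := @cvg_harmonic R; exact.
Unshelve. all: by end_near. Qed.

(** * Local boundedness *)

(** With [y k / r k] tending to [u], the points [(1 - t / r k) x + (t / r k) y k] are convex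
    combinations once [r k >= t], and they tend to [x + t u]. *)
Lemma asymptotic_cone_ray (R : realType) (n : nat) (K : set 'rV[R]_n)
    (x u : 'rV[R]_n) (t : R) :
  closed K -> convex_set K -> K x -> asymptotic_cone K u -> 0 <= t ->
  K (x + t *: u).
Proof.
move=> Kc Kv Kx [r [y [roo Ky yu]]] t0.
have r0 : \forall k \near \oo, 0 < r k by exact: cvgry_gt.
have r'0 : (r k)^-1 @[k --> \oo] --> 0 by apply/gtr0_cvgV0.
apply: (@closed_cvg _ _ \oo _
  (fun k => (1 - t * (r k)^-1) *: x + t *: ((r k)^-1 *: y k)) K) => //;
    last first.
  have -> : x + t *: u = (1 - t * 0) *: x + t *: u.
    by rewrite mulr0 subr0 scale1r.
  apply: cvgD; last by apply: cvgZ => //; exact: cvg_cst.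
  apply: cvgZ; last exact: cvg_cst.
  apply: cvgB; first exact: cvg_cst.
  by apply: cvgM => //; exact: cvg_cst.
near=> k; have rk : 0 < r k by near: k.
have c0 : 0 <= t * (r k)^-1 by rewrite mulr_ge0// invr_ge0 ltW.
have c1 : t * (r k)^-1 <= 1.
  rewrite ler_pdivrMr// mul1r; near: k; exact: cvgry_ge.
have := Kv (y k) x (Itv01 c0 c1); rewrite !inE => /(_ (Ky k) Kx).
by rewrite scalerA addrC.
Unshelve. all: by end_near. Qed.

Lemma locally_bounded_solution_map (R : realType) (n s : nat)
    (K : set 'rV[R]_n) (p : vpoly R n s) (d : 'I_s -> nat) :
  K !=set0 -> closed K -> convex_set K -> GR K d p ->
  exists2 delta : R, 0 < delta &
    bounded_set (\bigcup_(q in Pball d p delta) solution_map K q).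
Proof.
move=> [x0 Kx0] Kc Kv [pd /pinfty_ex_gt0[M M0 regM]].
apply: contrapT => unb.
have /choice[q /choice[x qx]] : forall k : nat, exists q, exists x,
    [/\ Pball d p (harmonic k) q, solution_map K q x & k%:R < `|x|].
  move=> k; apply: contra_notP unb => nqx.
  exists (harmonic k); first exact: harmonic_gt0.
  exists k%:R; split=> [|B kB x [q pq qx]]; first exact: num_real.
  apply: contra_notP nqx => /negP; rewrite -ltNge => Bx.
  by exists q, x; split=> //; exact: lt_trans Bx.
(* [x k] is rescaled to norm [M + 1] rather than [1]: the limit is then at once
   a solution of the recession problem outside the ball of radius [M]. *)
pose c := M + 1; have c0 : 0 < c by rewrite addr_gt0.
pose t k := `|x k| / c.
have t0 k : 0 < t k.
  by have [_ _ kx] := qx k; rewrite divr_gt0// (le_lt_trans _ kx).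
have too : t k @[k --> \oo] --> +oo.
  apply/cvgryPge => A; near=> k; rewrite ler_pdivlMr//.
  have [_ _ /ltW kx] := qx k; apply: le_trans kx.
  by near: k; exact: nbhs_infty_ger.
pose y k := (t k)^-1 *: x k.
have yc k : `|y k| = c.
  rewrite normrZ gtr0_norm ?invr_gt0// invfM invrK mulrAC mulVf ?mul1r//.
  by have [_ _ kx] := qx k; rewrite gt_eqF// (le_lt_trans _ kx).
have [phi [w [phioo yw]]] :=
  bounded_subsequence (fun k => eq_ind_r (fun a => a <= c) (lexx c) (yc k)).
have tphi : t (phi k) @[k --> \oo] --> +oo by exact: cvg_comp phioo too.
have Vtphi : (t (phi k))^-1 @[k --> \oo] --> 0.
  by apply/gtr0_cvgV0 => //; exact: nearW.
have wc : `|w| = c.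
  have : `|y (phi k)| @[k --> \oo] --> `|w| by exact: cvg_norm.
  under eq_cvg do rewrite yc.
  by move=> /cvg_lim <- //; rewrite lim_cst.
suff : weak_pareto (asymptotic_cone K) (recession p) w.
  by move=> /regM /=; rewrite wc /c gerDl ler10.
apply/weak_paretoE; split.
  exists (t \o phi), (x \o phi); split=> // k.
  by have [_ []] := qx (phi k).
move=> u Ku.
have coef i (m : bmultinom n (d i).+1) :
    mcoeff (bmnm m) (q (phi k) i) @[k --> \oo] --> mcoeff (bmnm m) (p i).
  apply: (cvg_comp phi (fun k => mcoeff (bmnm m) (q k i)) phioo).
  by apply: cvg_coef_Pball => k; have [] := qx k.
(* The competitor [x0 + t (phi k) *: u] of [x (phi k)], divided by [t (phi k)]. *)
pose z k := u + (t (phi k))^-1 *: x0.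
have zu : z k @[k --> \oo] --> u.
  rewrite -[X in _ --> X]addr0 -(scale0r x0).
  by apply: cvgD; [exact: cvg_cst|apply: cvgZ => //; exact: cvg_cst].
have [|||i] := @cvg_exists_le R 'I_s nat \oo _
  (fun i k => homogenization (d i) (q (phi k) i) (t (phi k))^-1 (y (phi k)))
  (fun i k => homogenization (d i) (q (phi k) i) (t (phi k))^-1 (z k))
  (fun i => homogenization (d i) (p i) 0 w)
  (fun i => homogenization (d i) (p i) 0 u).
- move=> k; have [[qd _] /weak_paretoE[Kx xmin] _] := qx (phi k).
  have tk := t0 (phi k).
  have [i] := xmin _ (asymptotic_cone_ray Kc Kv Kx0 Ku (ltW tk)).
  rewrite !mxE => xi; exists i.
  rewrite -!peval_scale ?gt_eqF// ler_pM2r ?invr_gt0 ?exprn_gt0//.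
  by rewrite scalerDr !scalerA divff ?gt_eqF// !scale1r addrC.
- by move=> i; exact: cvg_homogenization.
- by move=> i; exact: cvg_homogenization.
(* The degree of [p i] is exactly [d i], so the slice at 0 is its recession polynomial; the
   perturbed polynomials only needed degree at most [d i]. *)
by exists i; rewrite !recessionE pd.
Unshelve. all: by end_near. Qed.

(** * Upper semi-continuity *)

Lemma upper_semicontinuous_solution_map (R : realType) (n s : nat)
    (K : set 'rV[R]_n) (p : vpoly R n s) (d : 'I_s -> nat) (delta : R) :
  closed K -> Pspace d p -> 0 < delta ->
  bounded_set (\bigcup_(q in Pball d p delta) solution_map K q) ->
  upper_semicontinuous_at (Pnbhs d) (solution_map K) p.
Proof.
move=> Kc pd delta0 /pinfty_ex_gt0[M M0 bndM] U /set_nbhsP[V [oV pV VU]].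
apply: contrapT => nU.
(* Radius below [delta] keeps the solutions bounded; radius below [harmonic k] makes the
   coefficients converge. *)
have /choice[q /choice[x qx]] : forall k : nat, exists q, exists x,
    [/\ Pball d p (Num.min delta (harmonic k)) q, solution_map K q x & ~ V x].
  move=> k; apply: contra_notP nU => nqx.
  exists (Num.min delta (harmonic k)) => [|q pq x qx].
    by rewrite /= lt_min delta0/=.
  by apply: VU; apply: contra_notP nqx => Vx; exists q, x.
have xM k : `|x k| <= M.
  have [[qd +] qxk _] := qx k; rewrite lt_min => /andP[qdelta _].
  by apply: bndM; exists (q k).
have [phi [w [phioo xw]]] := bounded_subsequence xM.
have coef i (m : bmultinom n (d i).+1) :
    mcoeff (bmnm m) (q (phi k) i) @[k --> \oo] --> mcoeff (bmnm m) (p i).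
  apply: (cvg_comp phi (fun k => mcoeff (bmnm m) (q k i)) phioo).
  apply: cvg_coef_Pball => k; have [[qd +] _ _] := qx k.
  by rewrite lt_min => /andP[_ qk]; split.
(* The complement of [V] is closed, so [w] lies outside [V], which contains all solutions for
   [p]. *)
suff /pV : solution_map K p w.
  apply: (@closed_cvg _ _ \oo _ (x \o phi) (~` V) (open_closedC oV)) => //.
  by apply: nearW => k; have [] := qx (phi k).
apply/weak_paretoE; split.
  apply: (@closed_cvg _ _ \oo _ (x \o phi) K Kc) => //.
  by apply: nearW => k; have [_ []] := qx (phi k).
move=> u Ku.
(* No rescaling here: the slice at 1 is the polynomial itself, and the competitor [u] stays
   fixed. *)
have [|||i] := @cvg_exists_le R 'I_s nat \oo _
  (fun i k => homogenization (d i) (q (phi k) i) 1 (x (phi k)))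
  (fun i k => homogenization (d i) (q (phi k) i) 1 u)
  (fun i => homogenization (d i) (p i) 1 w)
  (fun i => homogenization (d i) (p i) 1 u).
- move=> k; have [[qd _] /weak_paretoE[_ /(_ u Ku)[i]] ] := qx (phi k).
  by rewrite !mxE !(@peval_homogenization _ _ (d i))// => ? _; exists i.
- by move=> i; apply: cvg_homogenization => //; exact: cvg_cst.
- by move=> i; apply: cvg_homogenization => //; exact: cvg_cst.
by exists i; rewrite !mxE !(@peval_homogenization _ _ (d i)).
Qed.

Unset Implicit Arguments.

Theorem theorem6p2 (R : realType) (n s : nat) (K : set 'rV[R]_n)
  (K_nonempty : K !=set0) (K_closed : closed K) (K_convex : convex_set K)
  (f : vpoly R n s) (d : 'I_s -> nat)
  (deg_f : forall i, pdeg (f i) = d i) (d_ge1 : forall i, (1 <= d i)%N)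
  (f_regular : strongly_regular K f) :
  (exists delta : R, 0 < delta /\
     bounded_set (\bigcup_(h in Pball d 0 delta) solution_map K (f + h))) /\
  (forall p : vpoly R n s, GR K d p ->
     upper_semicontinuous_at (Pnbhs d) (solution_map K) p).
Proof.
split=> [|p pGR].
  have [delta delta0 [M [Mr bnd]]] :=
    locally_bounded_solution_map K_nonempty K_closed K_convex
      (conj deg_f f_regular).
  exists delta; split=> //; exists M; split=> // B MB x [h [hd hdelta] hx].
  (* Translation by [f] maps the ball about 0 into the ball about [f]: adding [h] keeps the degrees
     at most [d], and [f + h - f = h]. *)
  apply: (bnd B MB); exists (f + h) => //; split=> [i|].
    have := hd i; have := mmeasureD_le mdeg (f i) (h i).
    by rewrite -(deg_f i) /pdeg leq_max => /orP[] /(leq_sub2r 1);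
      rewrite !subn1 => // /leq_trans; apply.
  by rewrite addrAC subrr add0r -[h]subr0.
have [delta delta0 bnd] :=
  locally_bounded_solution_map K_nonempty K_closed K_convex pGR.
by apply: upper_semicontinuous_solution_map delta0 bnd => // i; case: pGR => ->.
Qed.
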